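(* Let $\mathfrak{g}=\mathfrak{aff}(\mathbb{R})\oplus\mathbb{R}$ be equipped with a Lorentzian metric $q$, and let $\mathfrak{z}$ and $\mathfrak{d}=[\mathfrak{g},\mathfrak{g}]$ be the center and the derived subalgebra of $\mathfrak{g}$, respectively (both are one-dimensional). Then: <br> (a) if $\mathfrak{z}$ is spacelike, then $q$ is incomplete and its geodesic field has idempotents; <br> (b) if $\mathfrak{z}$ is timelike, then $q$ is complete and all integral curves of the geodesic field are bounded; <br> (c) if $\mathfrak{z}$ is lightlike, then <br> (c.1) if $\mathfrak{z}$ and $\mathfrak{d}$ are not orthogonal with respect to $q$, then $q$ is incomplete and its geodesic field has no idempotents; <br> (c.2) if $\mathfrak{z}$ and $\mathfrak{d}$ are orthogonal with respect to $q$, then $q$ is complete and all non-stationary integral curves of the geodesic field are unbounded.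
   Context: $\mathfrak{aff}(\mathbb{R})\oplus\mathbb{R}$ is the real 3-dimensional Lie algebra with a basis $\{e_1,e_2,e_3\}$ whose only nontrivial bracket relation is $[e_1,e_2]=e_2$ (so $\mathfrak{z}=\mathrm{span}\{e_3\}$ and $\mathfrak{d}=\mathrm{span}\{e_2\}$). A Lorentzian metric on a 3-dimensional real Lie algebra $\mathfrak{g}$ is a non-degenerate symmetric bilinear form $q$ on $\mathfrak{g}$ of signature $(+,+,-)$. A nonzero vector $v$, or the line it spans, is spacelike, timelike or lightlike if $q(v,v)>0$, $q(v,v)<0$ or $q(v,v)=0$, respectively. The geodesic field of $(\mathfrak{g},q)$ is the quadratic vector field $F$ on $\mathfrak{g}$ given by $F(v)=\mathrm{ad}^\dagger_v v$, where $\mathrm{ad}^\dagger_v$ is the $q$-transpose of $\mathrm{ad}_v$; that is, $q(F(v),w)=q(v,[v,w])$ for all $v,w\in\mathfrak{g}$. Its integral curves are the solutions of $\dot v=F(v)$, always taken with maximal domain of definition. $(\mathfrak{g},q)$ (or simply $q$) is called (geodesically) complete if the left-invariant metric defined by $q$ on a Lie group $G$ with Lie algebra $\mathfrak{g}$ is geodesically complete; equivalently (Euler–Arnold), if the geodesic field is a complete vector field, i.e. all its maximal integral curves are defined on all of $\mathbb{R}$. Otherwise $q$ is incomplete. An idempotent of the geodesic field is a nonzero vector $v_o\in\mathfrak{g}$ with $F(v_o)=v_o$. An integral curve is stationary if it is constant, and bounded if its image is a bounded subset of the vector space $\mathfrak{g}$. *)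

(* Defs.v *)
From HB Require Import structures.
From mathcomp Require Import all_boot all_order all_algebra.
From mathcomp Require Import all_classical all_reals all_analysis.

Set Implicit Arguments.
Unset Strict Implicit.
Unset Printing Implicit Defensive.

Import Order.TTheory GRing.Theory Num.Theory.
Import numFieldNormedType.Exports.

Local Open Scope classical_set_scope.
Local Open Scope ring_scope.

Section LieAlgebra.
Variables (K : fieldType) (V : vectType K).
Implicit Types br : {bilinear V -> V -> V}.

Definition lie_bracket br : Prop :=
  (forall x, br x x = 0) /\
  (forall x y z, br x (br y z) + br y (br z x) + br z (br x y) = 0).

(* The brackets of basis vectors that are not listed follow from
   antisymmetry *)
Definition aff_plus_R br : Prop :=
  lie_bracket br /\
  exists e1 e2 e3 : V,
    [/\ basis_of {:V} [:: e1; e2; e3],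
        br e1 e2 = e2, br e1 e3 = 0 & br e2 e3 = 0].

Definition lie_center br : set V := [set z | forall x, br z x = 0].

(* The smallest subspace containing all brackets *)
Definition derived_subalgebra br : set V :=
  [set v | forall U : {vspace V}, (forall x y, br x y \in U) -> v \in U].

Definition line (v : V) : set V := [set x | x \in <[v]>%VS].

Definition one_dimensional (L : set V) : Prop :=
  exists2 v, v != 0 & L = line v.

End LieAlgebra.

Section Adjoint.
Variables (K : fieldType) (V : vectType K).
Implicit Types (q : {symmetric V}) (br : {bilinear V -> V -> V}).

(* The value at v of the q-transpose of f: the vector u such that
   q u w = q v (f w) for all w (see qtransposeP) *)
Definition qtranspose q (f : V -> V) (v : V) : V :=
  xget 0 [set u | forall w, q u w = q v (f w)].

Lemma qtransposeP q (f : {linear V -> V}) : nondegenerate q ->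
  forall v w, q (qtranspose q f v) w = q v (f w).
Proof.
move=> qnd v w; rewrite /qtranspose.
case: xgetP => [u _ //|no_u]; exfalso.
pose b := vbasis {:V}.
pose g (u : V) : 'rV[K]_(\dim {:V}) := \row_i q u b`_i.
have g_lin : linear g.
  by move=> a x y; apply/rowP => i; rewrite !mxE linearPl.
pose gL := HB.pack_for {linear V -> 'rV[K]_(\dim {:V})} g
  (GRing.isLinear.Build K V 'rV[K]_(\dim {:V}) _ g g_lin).
pose G : 'Hom(V, 'rV[K]_(\dim {:V})) := linfun gL.
have q_ext u h : (forall i : 'I_(\dim {:V}), q u b`_i = h b`_i) ->
    linear_for *%R h -> forall x, q u x = h x.
  move=> eqb hlin x; pose hL := HB.pack_for {linear V -> K | *%R} h
    (GRing.isLinear.Build K V K _ h hlin).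
  rewrite (coord_vbasis (memvf x)) linear_sumr -[RHS]/(hL _) linear_sum.
  apply: eq_bigr => i _.
  by rewrite linearZr_LR linearZ_LR /= eqb.
have Gker : lker G == 0%VS.
  rewrite -subv0; apply/subvP => u; rewrite memv_ker lfunE /= => /eqP/rowP gu0.
  rewrite memv0 -memv0 -(eqP qnd); apply/mem_orthovP => x _.
  apply: (q_ext u (fun=> 0)) => [i|a y y']; last by rewrite mulr0 addr0.
  by have := gu0 i; rewrite !mxE.
have Gim : limg G = fullv.
  apply/eqP; rewrite eqEdim subvf /= limg_dim_eq ?(eqP Gker) ?capv0 //.
  by rewrite !dimvf /dim /= mul1n.
have : (\row_i q v (f b`_i) : 'rV[K]_(\dim {:V})) \in limg G.
  by rewrite Gim memvf.
move=> /memv_imgP[u _ /rowP Gu]; apply: (no_u u) => /=.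
apply: (q_ext u (fun x => q v (f x))) => [i|a y y'].
  by have := Gu i; rewrite lfunE /= !mxE.
by rewrite linearP linearPr.
Qed.

Definition geodesic_field q br (v : V) : V := qtranspose q (br v) v.

Lemma geodesic_fieldP q br : nondegenerate q ->
  forall v w, q (geodesic_field q br v) w = q v (br v w).
Proof. by move=> qnd v w; rewrite /geodesic_field qtransposeP. Qed.

End Adjoint.

Section Causal.
Variables (R : realType) (V : vectType R).
Implicit Types (q : {symmetric V}) (L M : set V).

Definition lorentzian q : Prop :=
  nondegenerate q /\
  exists b1 b2 b3 : V,
    [/\ basis_of {:V} [:: b1; b2; b3],
        [/\ q b1 b2 = 0, q b1 b3 = 0 & q b2 b3 = 0] &
        [/\ 0 < q b1 b1, 0 < q b2 b2 & q b3 b3 < 0]].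

Definition spacelike q L : Prop :=
  exists v, [/\ v != 0, L = line v & 0 < q v v].

Definition timelike q L : Prop :=
  exists v, [/\ v != 0, L = line v & q v v < 0].

Definition lightlike q L : Prop :=
  exists v, [/\ v != 0, L = line v & q v v = 0].

Definition orthogonal_sets q L M : Prop :=
  forall x y, L x -> M y -> q x y = 0.

End Causal.

Section VectorField.
Variables (R : realType) (V : normedModType R).
Implicit Types (F : V -> V) (I : set R) (c : R -> V).

(* Only the restriction of c to the open interval I matters *)
Definition solution F I c : Prop :=
  [/\ I !=set0, open I, is_interval I &
      forall t, I t -> is_derive t 1 c (F (c t))].

(* Solutions with maximal domain of definition *)
Definition integral_curve F I c : Prop :=
  solution F I c /\
  forall J d, solution F J d -> I `<=` J -> (forall t, I t -> d t = c t) ->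
    J = I.

(* For F the geodesic field of a metric q on a Lie algebra this is, by
   Euler-Arnold, geodesic completeness of the left-invariant metric that q
   defines on any Lie group with this Lie algebra *)
Definition complete_field F : Prop :=
  forall I c, integral_curve F I c -> I = setT.

Definition stationary I c : Prop := exists v, forall t, I t -> c t = v.

Definition bounded_curve I c : Prop := bounded_set (c @` I).

Definition is_idempotent F (v : V) : Prop := v != 0 /\ F v = v.

End VectorField.

(* Main.v *)
(* Write v = a e1 + b e2 + c e3 with [e1, e2] = e2, so that z = <e3>, d = <e2>,
   and p_i = q(v, e_i).  The geodesic equation reads p1' = - b p2, p2' = a p2,
   p3' = 0, besides which q(v, v) is conserved.

   If e3 is spacelike, the orthogonal complement of z is Lorentzian; a null
   vector v in it with a = 1 is idempotent, and - v / t blows up at t = 0.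

   If <e2, e3> is nondegenerate, e1 can be chosen orthogonal to it; with x = a
   and y = p2 the equation becomes x' = - (h y^2 + m y), y' = x y, where h and m
   are constant along the solution.  When e3 is timelike, h > 0 and the
   conserved energy x^2 + h y^2 + 2 m y bounds x and y; global solutions are
   explicit because 1 / y satisfies a linear equation.  When e3 is lightlike,
   h = 0 and x = - 2 / t, y = - 2 / t^2 blows up (for m = 1).

   If e3 is lightlike and orthogonal to e2, then a is constant and the system
   is triangular: p2 is exponential, and p1 is obtained by integrating p2^2. *)
Require Import Defs.
From HB Require Import structures.
From mathcomp Require Import all_boot all_order all_algebra.
From mathcomp Require Import all_classical all_reals all_analysis.
From mathcomp Require Import ring lra.

Set Implicit Arguments.
Unset Strict Implicit.
Unset Printing Implicit Defensive.

Import Order.TTheory GRing.Theory Num.Theory.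
Import numFieldNormedType.Exports.

Local Open Scope classical_set_scope.
Local Open Scope ring_scope.

(** * Real functions and planar systems *)

Section RealODE.
Variable R : realType.
Implicit Types (f g x y : R -> R) (I : set R) (s t : R).

Lemma is_derive_continuous (V : normedModType R) (f : R -> V) t (df : V) :
  is_derive t 1 f df -> {for t, continuous f}.
Proof. by move=> [/derivable1_diffP/differentiable_continuous]. Qed.

Lemma nonincreasing_on I f (df : R -> R) : is_interval I ->
  (forall t, I t -> is_derive t 1 f (df t)) -> (forall t, I t -> df t <= 0) ->
  forall s t, I s -> I t -> s <= t -> f t <= f s.
Proof.
move=> Iitv fD df0 s t Is It st.
have sub r : r \in `[s, t] -> I r.
  by rewrite in_itv /= => /andP[sr rt]; apply: (Iitv s t) => //; rewrite sr rt.
have [r|r|c cst] := MVT_segment (f := f) (df := df) st.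
- by rewrite in_itv => /andP[/ltW sr /ltW rt]; apply/fD/sub;
  rewrite in_itv /= sr.
- apply: continuous_in_subspaceT r => r; rewrite inE /= => /sub/fD.
  exact: is_derive_continuous.
rewrite -subr_le0 => ->.
by rewrite mulr_le0_ge0 ?df0 ?subr_ge0 //; exact: sub.
Qed.

Lemma is_derive_eqfun (V : normedModType R) (f g : R -> V) t (df dg : V) :
  is_derive t 1 f df -> f = g -> df = dg -> is_derive t 1 g dg.
Proof. by move=> + <- <-. Qed.

Lemma is_derive_const (a t : R) : is_derive t 1 (fun=> a) 0.
Proof. exact: is_derive_cst. Qed.

Lemma is_derive_var t : is_derive t 1 (fun s : R => s) 1.
Proof. exact: is_derive_id. Qed.

Lemma is_derive_add f g t (df dg : R) :
  is_derive t 1 f df -> is_derive t 1 g dg ->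
  is_derive t 1 (fun s => f s + g s) (df + dg).
Proof. by move=> fD gD; apply: is_deriveD. Qed.

Lemma is_derive_opp f t (df : R) : is_derive t 1 f df ->
  is_derive t 1 (fun s => - f s) (- df).
Proof. by move=> fD; apply: is_deriveN. Qed.

Lemma is_derive_mul f g t (df dg : R) :
  is_derive t 1 f df -> is_derive t 1 g dg ->
  is_derive t 1 (fun s => f s * g s) (df * g t + f t * dg).
Proof.
move=> fD gD; apply: is_derive_eqfun (is_deriveM fD gD) _ _ => //.
by rewrite /GRing.scale /= addrC [df * _]mulrC.
Qed.

Lemma is_derive_sqr f t (df : R) : is_derive t 1 f df ->
  is_derive t 1 (fun s => f s ^+ 2) (2 * f t * df).
Proof.
by move=> fD; apply: is_derive_eqfun (is_derive_mul fD fD) _ _ => //; ring.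
Qed.

Lemma is_derive_inv f t (df : R) : f t != 0 -> is_derive t 1 f df ->
  is_derive t 1 (fun s => (f s)^-1) (- df / (f t ^+ 2)).
Proof.
move=> f0 fD; apply: is_derive_eqfun (is_deriveV f0 fD) _ _ => //.
by rewrite /GRing.scale /= mulrC mulNr mulrN.
Qed.

Lemma is_derive_chain (f g : R -> R) t (a b : R) : is_derive (g t) 1 f a ->
  is_derive t 1 g b -> is_derive t 1 (fun s => f (g s)) (a * b).
Proof. exact: is_derive1_comp. Qed.

End RealODE.

Ltac derive_step := first
  [ eassumption
  | eapply is_derive_const | eapply is_derive_var
  | eapply is_derive_sqr | eapply is_derive_mul | eapply is_derive_add
  | eapply is_derive_opp
  | eapply (is_derive_chain (f := expR)); [eapply is_derive_expR|]
  | eapply (is_derive_chain (f := cos)); [eapply is_derive_cos|]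
  | eapply (is_derive_chain (f := sin)); [eapply is_derive_sin|]
  | eapply is_derive_inv ].
(** Leaves an identity between the claimed derivative and the computed one. Derivatives of unknown
    functions, and the nonvanishing of inverted ones, are taken from the context. *)
Ltac derive := eapply is_derive_eq; [repeat derive_step|rewrite /=].

(** * Gronwall estimate, the planar system and the triangular system *)

Section PlanarODE.
Variable R : realType.
Implicit Types (f g x y : R -> R) (I : set R) (s t : R).

(** After [t0] the function [f t * expR (- K * t)] is nonincreasing, and before [t0] the function
    [f t * expR (K * t)] is nondecreasing. Both vanish at [t0], so [f t <= 0] on either side. *)
Lemma gronwall I f (df : R -> R) K t0 : is_interval I ->
  (forall t, I t -> is_derive t 1 f (df t)) ->
  (forall t, I t -> `|df t| <= K * f t) ->
  I t0 -> f t0 = 0 -> (forall t, I t -> 0 <= f t) ->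
  forall t, I t -> f t = 0.
Proof.
move=> Iitv fD fK It0 f0 f_ge0 t It; apply/eqP; rewrite eq_le f_ge0 // andbT.
have [t0t|/ltW tt0] := leP t0 t.
- have dec : forall s, I s -> is_derive s 1 (fun s => f s * expR (- K * s))
      ((df s - K * f s) * expR (- K * s)).
    by move=> s Is; have sD := fD s Is; derive; ring.
  have := nonincreasing_on Iitv dec _ It0 It t0t; rewrite f0 mul0r.
  rewrite pmulr_lle0 ?expR_gt0 //; apply=> s Is.
  rewrite pmulr_lle0 ?expR_gt0 // subr_le0.
  exact: le_trans (ler_norm _) (fK s Is).
- have dec : forall s, I s -> is_derive s 1 (fun s => - (f s * expR (K * s)))
      (- ((df s + K * f s) * expR (K * s))).
    by move=> s Is; have sD := fD s Is; derive; ring.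
  have := nonincreasing_on Iitv dec _ It It0 tt0.
  rewrite f0 mul0r oppr0 oppr_ge0 pmulr_lle0 ?expR_gt0 //; apply=> s Is.
  rewrite oppr_le0 pmulr_lge0 ?expR_gt0 //.
  have := fK s Is; have := ler_norm (- df s); rewrite normrN; lra.
Qed.

Lemma constant_on I f : is_interval I ->
  (forall t, I t -> is_derive t 1 f 0) -> forall s t, I s -> I t -> f t = f s.
Proof.
move=> Iitv fD s t Is It.
have: (f t - f s) ^+ 2 = 0.
  apply: (gronwall (f := fun t => (f t - f s) ^+ 2) (df := cst 0) (K := 0)
    (t0 := s) (I := I)) => //.
  - by move=> r Ir; have rD := fD r Ir; derive; rewrite /=; ring.
  - by move=> r Ir; rewrite /= normr0 mul0r.
  - by rewrite subrr expr0n.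
  - by move=> r Ir; exact: sqr_ge0.
by move/eqP; rewrite sqrf_eq0 subr_eq0 => /eqP.
Qed.

(** The solutions are trigonometric for [E < 0], exponential for [E > 0] and quadratic for
    [E = 0]. *)
Lemma linear_ode_solution (E m w0 w1 t0 : R) : exists w dw : R -> R,
  [/\ w t0 = w0, dw t0 = w1,
      forall t, is_derive t 1 w (dw t) &
      forall t, is_derive t 1 dw (E * w t - m)].
Proof.
have [E0|E0|->] := ltgtP E 0.
- have [s s0 ->] : exists2 s, s != 0 & E = - s ^+ 2.
    exists (Num.sqrt (- E)); last by rewrite sqr_sqrtr ?oppr_ge0 ?opprK ?ltW.
    by rewrite gt_eqF // sqrtr_gt0 oppr_gt0.
  (* The equilibrium is [m / E = - (m / s ^+ 2)]; [c] is the initial deviation from it. *)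
  pose c := w0 + m / s ^+ 2.
  exists (fun t => - (m / s ^+ 2) + c * cos (s * (t - t0))
                   + w1 / s * sin (s * (t - t0))),
    (fun t => - (c * s * sin (s * (t - t0))) + w1 * cos (s * (t - t0))).
  rewrite /c; split=> [||t|t].
  + by rewrite subrr mulr0 cos0 sin0; ring.
  + by rewrite subrr mulr0 cos0 sin0; ring.
  + by derive; field.
  + by derive; field.
- have [s s0 ->] : exists2 s, s != 0 & E = s ^+ 2.
    exists (Num.sqrt E); last by rewrite sqr_sqrtr // ltW.
    by rewrite gt_eqF // sqrtr_gt0.
  pose c := w0 - m / s ^+ 2.
  (* The initial values require [a + b = c] and [s * (a - b) = w1]. *)
  pose a := (c + w1 / s) / 2; pose b := (c - w1 / s) / 2.
  exists (fun t => m / s ^+ 2 + a * expR (s * (t - t0))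
                   + b * expR (- s * (t - t0))),
    (fun t => a * s * expR (s * (t - t0)) - b * s * expR (- s * (t - t0))).
  rewrite /a /b /c; split=> [||t|t].
  + by rewrite subrr !mulr0 expR0; field.
  + by rewrite subrr !mulr0 expR0; field.
  + by derive; field.
  + by derive; field.
- exists (fun t => w0 + w1 * (t - t0) - m / 2 * (t - t0) ^+ 2),
    (fun t => w1 - m * (t - t0)); split=> [||t|t].
  + by rewrite subrr; ring.
  + by rewrite subrr; ring.
  + by derive; field.
  + by derive; ring.
Qed.

(* For y != 0, w := 1 / y satisfies the linear equation w'' = E w - m, where E
   is the conserved energy x^2 + h y^2 + 2 m y; conversely w never vanishes,
   since w'^2 = E w^2 - 2 m w - h and h > 0. *)
Lemma planar_solution (h m x0 y0 t0 : R) : 0 < h -> exists x y : R -> R,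
  [/\ x t0 = x0, y t0 = y0,
      forall t, is_derive t 1 x (- (h * y t ^+ 2 + m * y t)) &
      forall t, is_derive t 1 y (x t * y t)].
Proof.
move=> h0; have [->|y0N0] := eqVneq y0 0.
  exists (fun=> x0), (fun=> 0); split=> // t.
  - by derive; ring.
  - by derive; ring.
pose E := x0 ^+ 2 + h * y0 ^+ 2 + 2 * m * y0.
(* The initial slope of 1 / y is - y' / y^2 = - x / y, because y' = x y. *)
have [w [dw [wt0 dwt0 wD dwD]]] := linear_ode_solution E m y0^-1 (- x0 / y0) t0.
have inv t : dw t ^+ 2 - E * w t ^+ 2 + 2 * m * w t = - h.
  have wE s : is_derive s 1
      (fun t => dw t ^+ 2 - E * w t ^+ 2 + 2 * m * w t) 0.
    by have sD := wD s; have sD' := dwD s; derive; ring.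
  rewrite (is_derive_0_is_cst t t0 wE) wt0 dwt0 /E.
  by field.
have w0 t : w t != 0.
  apply/eqP => w0; have := inv t; rewrite w0 => dw2.
  have : 0 <= dw t ^+ 2 by exact: sqr_ge0.
  by lra.
exists (fun t => - (dw t / w t)), (fun t => (w t)^-1); split=> [||t|t].
- by rewrite wt0 dwt0; field.
- by rewrite wt0 invrK.
- have tD := wD t; have tD' := dwD t; have wN0 := w0 t; derive.
  apply/eqP; rewrite -subr_eq0; apply/eqP.
  have -> : h = - (dw t ^+ 2 - E * w t ^+ 2 + 2 * m * w t) by rewrite inv opprK.
  by field.
- have tD := wD t; have wN0 := w0 t; derive.
  by field.
Qed.

(** The contributions 2 x x' and 2 (h y + m) y' cancel, whatever the sign of [h]. *)
Lemma planar_energy (h m t0 : R) I x y : is_interval I -> I t0 ->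
  (forall t, I t -> is_derive t 1 x (- (h * y t ^+ 2 + m * y t))) ->
  (forall t, I t -> is_derive t 1 y (x t * y t)) ->
  forall t, I t -> x t ^+ 2 + h * y t ^+ 2 + 2 * m * y t =
    x t0 ^+ 2 + h * y t0 ^+ 2 + 2 * m * y t0.
Proof.
move=> Iitv It0 xD yD t It.
apply: (@constant_on I (fun t => x t ^+ 2 + h * y t ^+ 2 + 2 * m * y t)) => //.
by move=> s Is; have sD := xD s Is; have sD' := yD s Is; derive; ring.
Qed.

(** Completing the square gives a^2 + h (b + m / h)^2 = E + m^2 / h. The bound depends only on [h],
    [m] and [E], so it holds along a whole solution at once. *)
Lemma planar_bounded (h m E : R) : 0 < h -> exists2 M, 0 <= M & forall a b : R,
  a ^+ 2 + h * b ^+ 2 + 2 * m * b = E -> `|a| <= M /\ `|b| <= M.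
Proof.
move=> h0; pose N := E + m ^+ 2 / h.
exists (1 + `|N| + `|N| / h + `|m / h|) => [|a b ab].
  have := ltW h0 => h0l; rewrite !addr_ge0 // divr_ge0 //.
(* A bound free of square roots: either [|u| <= 1] or [|u| <= u ^+ 2]. *)
have sqb (u v : R) : u ^+ 2 <= v -> `|u| <= 1 + v.
  move=> uv; have [u1|u1] := leP `|u| 1.
    by apply: le_trans u1 _; rewrite lerDl; exact: le_trans (sqr_ge0 _) uv.
  suff: `|u| <= u ^+ 2 by lra.
  rewrite -real_normK ?num_real //; nra.
have eN : a ^+ 2 + h * (b + m / h) ^+ 2 = N.
  by rewrite /N -ab; field; rewrite gt_eqF.
have Nn : N <= `|N| by exact: ler_norm.
have hN : 0 <= `|N| / h by rewrite divr_ge0 // ltW.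
have nmh : 0 <= `|m / h| by [].
have a2 : 0 <= a ^+ 2 by exact: sqr_ge0.
have b2 : 0 <= h * (b + m / h) ^+ 2 by rewrite mulr_ge0 ?sqr_ge0 // ltW.
split.
  have : `|a| <= 1 + `|N| by apply: sqb; lra.
  by lra.
have bb : `|b + m / h| <= 1 + `|N| / h.
  by apply: sqb; rewrite ler_pdivlMr // mulrC; lra.
have : `|b| <= `|b + m / h| + `|m / h|.
  by rewrite -{1}(addrK (m / h) b); exact: ler_normB.
have : 0 <= `|N| by [].
by lra.
Qed.

(** Equal initial values give equal energies, so one [M] bounds both solutions on all of [I]. Within
    this bound the quadratic right-hand side is Lipschitz, and [gronwall] applies to the squared
    distance [S]. *)
Lemma planar_unique (h m t0 : R) I x y u v : 0 < h -> is_interval I -> I t0 ->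
  (forall t, I t -> is_derive t 1 x (- (h * y t ^+ 2 + m * y t))) ->
  (forall t, I t -> is_derive t 1 y (x t * y t)) ->
  (forall t, I t -> is_derive t 1 u (- (h * v t ^+ 2 + m * v t))) ->
  (forall t, I t -> is_derive t 1 v (u t * v t)) ->
  x t0 = u t0 -> y t0 = v t0 -> forall t, I t -> x t = u t /\ y t = v t.
Proof.
move=> h0 Iitv It0 xD yD uD vD xu yv.
pose E := x t0 ^+ 2 + h * y t0 ^+ 2 + 2 * m * y t0.
have [M M0 ME] := planar_bounded m E h0.
pose S t := (x t - u t) ^+ 2 + (y t - v t) ^+ 2.
(* The derivative of [S], regrouped by y^2 - v^2 = (y - v) (y + v) and x y - u v = x (y - v) + v (x
   - u). *)
pose dS t := 2 * (x t - u t) * (v t - h * (y t + v t) - m) * (y t - v t)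
  + 2 * x t * (y t - v t) ^+ 2.
have S0 t : I t -> S t = 0.
  apply: (gronwall (df := dS) (t0 := t0) (K := 3 * M + 2 * h * M + `|m|)) => //.
  - move=> s Is; have D1 := xD s Is; have D2 := yD s Is; have D3 := uD s Is.
    by have D4 := vD s Is; rewrite /S /dS; derive; ring.
  - move=> s Is; rewrite /dS /S.
    have [xM yM] := ME _ _ (planar_energy Iitv It0 xD yD Is).
    have [uM vM] : `|u s| <= M /\ `|v s| <= M.
      by apply: ME; rewrite (planar_energy Iitv It0 uD vD Is) /E xu yv.
    move: (x s - u s) (y s - v s) => p r.
    have pr : `|2 * p * r| <= p ^+ 2 + r ^+ 2.
      have := sqr_ge0 (p - r); have := sqr_ge0 (p + r) => H1 H2.
      by rewrite ler_norml; apply/andP; split; nra.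
    have cM : `|v s - h * (y s + v s) - m| <= M + 2 * h * M + `|m|.
      rewrite (le_trans (ler_normB _ _)) // lerD2r.
      rewrite (le_trans (ler_normB _ _)) // lerD // normrM (gtr0_norm h0).
      rewrite (mulrC 2) -mulrA ler_pM2l // (le_trans (ler_normD _ _)) //.
      by lra.
    have -> : 2 * p * (v s - h * (y s + v s) - m) * r + 2 * x s * r ^+ 2 =
      (2 * p * r) * (v s - h * (y s + v s) - m) + 2 * x s * r ^+ 2 by ring.
    rewrite (le_trans (ler_normD _ _)) //.
    have -> : (3 * M + 2 * h * M + `|m|) * (p ^+ 2 + r ^+ 2) =
      (p ^+ 2 + r ^+ 2) * (M + 2 * h * M + `|m|) + 2 * M * (p ^+ 2 + r ^+ 2).
      by ring.
    rewrite lerD //; first by rewrite normrM ler_pM.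
    rewrite normrM (ger0_norm (sqr_ge0 r)) ler_pM ?sqr_ge0 //.
      by rewrite normrM normr_nat ler_pM2l.
    by rewrite lerDr sqr_ge0.
  - by rewrite /S xu yv !subrr expr0n /= addr0.
  - by move=> s _; rewrite /S addr_ge0 ?sqr_ge0.
move=> t /S0 /eqP; rewrite /S paddr_eq0 ?sqr_ge0 // !sqrf_eq0 !subr_eq0.
by move=> /andP[/eqP -> /eqP ->].
Qed.

(** If [a = 0], then [y] is constant and [z] affine; otherwise [y] is exponential and [z] integrates
    its square. The last clause prepares unboundedness: for [y0 != 0], it is [z] that exceeds every
    bound if [a = 0], and [y] if not. *)
Lemma triangular_solution (a B y0 z0 t0 : R) : B != 0 ->
  exists y z : R -> R,
  [/\ y t0 = y0, z t0 = z0, forall t, is_derive t 1 y (a * y t),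
      forall t, is_derive t 1 z (- (y t ^+ 2 / B)) &
      (y0 = 0 -> forall t, y t = 0 /\ z t = z0) /\
      (y0 != 0 -> forall K, exists t, K < `|y t| \/ K < `|z t|)].
Proof.
move=> B0; have [->|a0] := eqVneq a 0.
  exists (fun=> y0), (fun t => z0 - y0 ^+ 2 / B * (t - t0)).
  split=> [||t|t|] //; first by rewrite subrr mulr0 subr0.
  - by derive; ring.
  - by derive; ring.
  split=> [-> t|y00 K]; first by rewrite expr0n /= !mul0r subr0.
  (* The time at which the affine function [z] takes the value [|K| + 1]. *)
  exists (t0 + (z0 - (`|K| + 1)) / (y0 ^+ 2 / B)); right.
  have -> : z0 - y0 ^+ 2 / B * (t0 + (z0 - (`|K| + 1)) / (y0 ^+ 2 / B) - t0) =
    `|K| + 1 by field; rewrite y00 B0.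
  have := ler_norm K; have := ler_norm (`|K| + 1); lra.
exists (fun t => y0 * expR (a * (t - t0))),
  (fun t => z0 - y0 ^+ 2 / (2 * a * B) * (expR (a * (t - t0)) ^+ 2 - 1)).
split=> [||t|t|].
- by rewrite subrr mulr0 expR0 mulr1.
- by rewrite subrr mulr0 expR0 expr1n subrr mulr0 subr0.
- by derive; ring.
- by derive; field; rewrite a0 B0.
split=> [-> t|y00 K]; first by rewrite expr0n /= !mul0r subr0.
(* At this time |y| = |y0| exp (K / |y0|), which is at least |y0| + K. *)
exists (t0 + (K / `|y0|) / a); left.
have -> : a * (t0 + K / `|y0| / a - t0) = K / `|y0|.
  by field; rewrite normr_eq0 y00.
have y0_gt0 : 0 < `|y0| by rewrite normr_gt0.
rewrite normrM (gtr0_norm (expR_gt0 _)) mulrC -ltr_pdivrMr //.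
have := expR_ge1Dx (K / `|y0|); lra.
Qed.

(** [gronwall] on the square of [y - u] settles the first component; [z] and [v] then have equal
    derivatives. *)
Lemma triangular_unique (a B t0 : R) I y z u v : is_interval I -> I t0 ->
  (forall t, I t -> is_derive t 1 y (a * y t)) ->
  (forall t, I t -> is_derive t 1 z (- (y t ^+ 2 / B))) ->
  (forall t, I t -> is_derive t 1 u (a * u t)) ->
  (forall t, I t -> is_derive t 1 v (- (u t ^+ 2 / B))) ->
  y t0 = u t0 -> z t0 = v t0 -> forall t, I t -> y t = u t /\ z t = v t.
Proof.
move=> Iitv It0 yD zD uD vD yu zv.
have yuE t : I t -> y t = u t.
  move=> It; have : (y t - u t) ^+ 2 = 0.
    apply: (gronwall (f := fun t => (y t - u t) ^+ 2) (t0 := t0) (I := I)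
      (df := fun t => 2 * a * (y t - u t) ^+ 2) (K := 2 * `|a|)) => //.
    - by move=> s Is; have D1 := yD s Is; have D2 := uD s Is; derive; ring.
    - by move=> s Is; rewrite normrM (ger0_norm (sqr_ge0 _)) normrM normr_nat.
    - by rewrite yu subrr expr0n.
    - by move=> s Is; exact: sqr_ge0.
  by move/eqP; rewrite sqrf_eq0 subr_eq0 => /eqP.
move=> t It; split; first exact: yuE.
apply/eqP; rewrite -subr_eq0; apply/eqP.
have -> : z t - v t = z t0 - v t0; last by rewrite zv subrr.
apply: (constant_on (f := fun t => z t - v t) Iitv) => // s Is.
have D1 := zD s Is; have D2 := vD s Is; derive.
by rewrite yuE //; ring.
Qed.

End PlanarODE.

(** * Linear maps and symmetric forms *)

Section LinearMaps.
Variable R : realType.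
Implicit Types t : R.

(** A linear map commutes with difference quotients, and continuity carries it through their
    limit. *)
Lemma is_derive_linear (U W : normedModType R) (f : U -> W) (c : R -> U) t dc :
  linear f -> continuous f -> is_derive t 1 c dc ->
  is_derive t 1 (fun s => f (c s)) (f dc).
Proof.
move=> f_lin f_cont [cD <-].
pose g := HB.pack_for {linear U -> W} f (GRing.isLinear.Build R U W _ f f_lin).
have lim : h^-1 *: (f (c (h *: 1 + t)) - f (c t)) @[h --> 0^'] --> f ('D_1 c t).
  have -> : (fun h => h^-1 *: (f (c (h *: 1 + t)) - f (c t))) =
      (fun h => f (h^-1 *: (c (h *: 1 + t) - c t))).
    by apply/funext => h; rewrite -[f]/(g : U -> W) linearZ_LR (linearB g).
  have cl : h^-1 *: (c (h *: 1 + t) - c t) @[h --> 0^'] --> 'D_1 c t.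
    exact: cD.
  exact: (cvg_comp _ f cl (f_cont _)).
apply: DeriveDef; first by apply/cvg_ex; eexists; exact: lim.
exact: cvg_lim lim.
Qed.

Lemma is_derive_scalel (V : normedModType R) (x : R -> R) t (dx : R) (e : V) :
  is_derive t 1 x dx -> is_derive t 1 (fun s => x s *: e) (dx *: e).
Proof.
move=> xD; apply: (is_derive_linear (f := fun a : R => a *: e) (U := R)) xD.
  by move=> a u v; rewrite scalerDl scalerA.
exact: scalel_continuous.
Qed.

Lemma is_derive_comb3 (V : normedModType R) (x y z : R -> R) t (dx dy dz : R)
    (e1 e2 e3 : V) :
  is_derive t 1 x dx -> is_derive t 1 y dy -> is_derive t 1 z dz ->
  is_derive t 1 (fun s => x s *: e1 + y s *: e2 + z s *: e3)
    (dx *: e1 + dy *: e2 + dz *: e3).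
Proof.
move=> xD yD zD.
have D1 := is_derive_scalel e1 xD; have D2 := is_derive_scalel e2 yD.
exact: (is_deriveD (is_deriveD D1 D2) (is_derive_scalel e3 zD)).
Qed.

End LinearMaps.

Section Form.
Variables (R : realType) (n : nat) (q : {symmetric 'rV[R]_n}).
Implicit Types (u v w : 'rV[R]_n) (t : R).

Lemma sformC u v : q u v = q v u.
Proof. by rewrite hermC expr0 mul1r. Qed.

Lemma form_expand u w : q u w = \sum_j u 0 j * q (delta_mx 0 j) w.
Proof.
rewrite sformC {1}(row_sum_delta u) linear_sumr; apply: eq_bigr => j _.
by rewrite linearZr_LR /= sformC.
Qed.

(** Each coordinate is at most the max norm of [u]. Hence a bounded curve has bounded products with
    any fixed vector. *)
Lemma form_bound w : exists2 K, 0 <= K & forall u, `|q u w| <= K * `|u|.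
Proof.
exists (\sum_j `|q (delta_mx 0 j) w|) => [|u]; first exact: sumr_ge0.
rewrite form_expand mulr_suml (le_trans (ler_norm_sum _ _ _)) //.
rewrite ler_sum // => j _.
rewrite normrM mulrC ler_wpM2l //.
by rewrite [leRHS]/Num.Def.normr/= mx_normrE (le_bigmax _ _ (0, j)).
Qed.

Lemma form_continuous w : continuous (fun u => q u w : R).
Proof.
have -> : (fun u => q u w) = (fun u => \sum_j u 0 j * q (delta_mx 0 j) w).
  by apply/funext => u; exact: form_expand.
apply: continuous_big => [|j _ u]; first exact: add_continuous.
have cj := @coord_continuous R 1 n 0 j u.
exact: (cvgM cj (cvg_cst (q (delta_mx 0 j) w))).

Qed.

Lemma is_derive_form (c : R -> 'rV[R]_n) t dc w : is_derive t 1 c dc ->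
  is_derive t 1 (fun s => q (c s) w : R) (q dc w).
Proof.
apply: (is_derive_linear (f := fun u => q u w : R));
  last exact: form_continuous.
by move=> a u v; rewrite linearPl.
Qed.

End Form.

(** * Vector fields and adapted frames *)

Section VectorFields.
Variables (R : realType) (V : normedModType R).
Implicit Types (F : V -> V) (c d : R -> V) (I : set R).

(** A maximal curve has no proper extension, so one that agrees with a global solution on its domain
    is itself global. *)
Lemma complete_of_global F :
  (forall I c t0, solution F I c -> I t0 ->
    exists2 d, (forall t : R, is_derive t 1 d (F (d t))) &
      forall t, I t -> d t = c t) ->
  complete_field F.
Proof.
move=> glob I c [csol cmax]; have [[t0 It0] _ _ _] := csol.
have [d dD dc] := glob I c t0 csol It0.
apply/esym; apply: (cmax _ d) => //; split=> //.
- by exists 0.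
- exact: openT.
Qed.

(** The curve is maximal on t > 0: an extension reaching some [s <= 0] would be defined at 0, as its
    domain is an interval, and continuous there. Then [t * phi (d t)] would tend to 0, whereas it
    equals [k] for t > 0. *)
Lemma incomplete_blowup F c (phi : V -> R) (k : R) : continuous phi -> k != 0 ->
  (forall t : R, 0 < t -> is_derive t 1 c (F (c t))) ->
  (forall t : R, 0 < t -> phi (c t) = k / t) ->
  ~ complete_field F.
Proof.
move=> phi_cont k0 cD phic F_complete.
suff /F_complete/seteqP[_ /(_ 0 Logic.I)] : integral_curve F [set t | 0 < t] c.
  by rewrite /= ltxx.
split.
  split=> //.
  - by exists 1 => /=.
  - move=> x y /= x0 y0 z /andP[xz _]; exact: lt_le_trans x0 xz.
move=> J d [_ _ Jitv dD] IJ dc; apply/seteqP; split=> // s Js /=.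
have [//|s0] := ltP 0 s; exfalso.
have J0 : J 0 by apply: (Jitv s 1) => //;
  [exact: (IJ _ ltr01) | rewrite s0 ler01].
have d0 := is_derive_continuous (dD 0 J0).
have lim0 : t * phi (d t) @[t --> (0 : R)] --> (0 : R) * phi (d 0).
  apply: cvgM; first exact: cvg_id.
  by apply: (cvg_comp _ phi d0); exact: phi_cont.
have lim1 : t * phi (d t) @[t --> (0 : R)^'+] --> (0 : R) * phi (d 0).
  exact: cvg_at_right_filter.
have lim2 : t * phi (d t) @[t --> (0 : R)^'+] --> k.
  apply: cvg_near_cst.
  near=> t.
  have t0 : 0 < t by near: t; exact: nbhs_right_gt.
  by rewrite dc // phic // mulrCA divff ?mulr1 // gt_eqF.
have /eqP : k = 0 * phi (d 0).
  exact: (cvg_unique (@norm_hausdorff _ _) lim2 lim1).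
by rewrite mul0r (negPf k0).
Unshelve. all: by end_near. Qed.

Lemma bounded_curve_of (I : set R) c (K : R) :
  (forall t, I t -> `|c t| <= K) -> bounded_curve I c.
Proof.
move=> cK; exists K; split; first exact: num_real.
by move=> M KM _ [t It <-]; apply: le_trans (ltW KM); exact: cK.
Qed.

Lemma bounded_curveP (I : set R) c :
  bounded_curve I c -> exists K : R, forall t, I t -> `|c t| <= K.
Proof.
move=> [K [_ cK]]; exists (K + 1) => t It.
by apply: cK; [rewrite ltrDl | exists t].
Qed.

End VectorFields.

(** * Frames adapted to the bracket *)

Section Frames.
Variables (R : realType) (V : vectType R).
Implicit Types (br : {bilinear V -> V -> V}) (v e : V) (q : {symmetric V}).

Lemma basis3P e1 e2 e3 : basis_of {:V} [:: e1; e2; e3] ->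
  (forall v, exists a b c, v = a *: e1 + b *: e2 + c *: e3) /\
  (forall a b c, a *: e1 + b *: e2 + c *: e3 = 0 -> [/\ a = 0, b = 0 & c = 0]).
Proof.
move=> bas; split=> [v|a b c abc0].
- pose X := [tuple e1; e2; e3].
  exists (coord X ord0 v), (coord X (lift ord0 ord0) v),
    (coord X (lift ord0 (lift ord0 ord0)) v).
  rewrite {1}(coord_basis (X := X) bas (memvf v)).
  by rewrite !big_ord_recl big_ord0 addr0 addrA.
- have /freeP fr : free [tuple e1; e2; e3] by exact: basis_free bas.
  have := fr (fun i => [:: a; b; c]`_i).
  rewrite !big_ord_recl big_ord0 addr0 addrA => /(_ abc0) H.
  by split; [have := H ord0 | have := H (lift ord0 ord0)
    | have := H (lift ord0 (lift ord0 ord0))].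
Qed.

(** The bracket table is kept as one coordinate formula, which is easy to carry along when [e1] is
    changed. *)
Record aff_frame br e1 e2 e3 : Prop := AffFrame {
  frame_span : forall v, exists a b c, v = a *: e1 + b *: e2 + c *: e3;
  frame_free : forall a b c,
    a *: e1 + b *: e2 + c *: e3 = 0 -> [/\ a = 0, b = 0 & c = 0];
  frame_br : forall a b c a' b' c',
    br (a *: e1 + b *: e2 + c *: e3) (a' *: e1 + b' *: e2 + c' *: e3) =
      (a * b' - b * a') *: e2 }.

Lemma aff_frame_exists br : aff_plus_R br ->
  exists e1 e2 e3, aff_frame br e1 e2 e3.
Proof.
move=> [[br_alt _] [e1 [e2 [e3 [/basis3P[sp fr] b12 b13 b23]]]]].
exists e1, e2, e3; split=> // a b c a' b' c'.
have brC u v : br u v = - br v u.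
  apply/eqP; rewrite -addr_eq0; have := br_alt (u + v).
  by rewrite linearDl !linearDr /= !br_alt add0r addr0 => ->.
rewrite !linearDl !linearDr /= !linearZl_LR !linearZr_LR /=.
rewrite !br_alt b12 b13 b23 (brC e2 e1) (brC e3 e1) (brC e3 e2) b12 b13 b23.
rewrite !oppr0 !scaler0 !addr0 !add0r !scalerN !scalerA -scalerBl.
by congr (_ *: _); ring.
Qed.

Section Frame.
Variables (br : {bilinear V -> V -> V}) (e1 e2 e3 : V).
Hypothesis fr : aff_frame br e1 e2 e3.

(** The shift keeps the first coordinate and adds a fixed multiple of it to the second, which
    cancels in a b' - b a'. This freedom serves to normalize [e1] against the metric. *)
Lemma aff_frame_shift b c : aff_frame br (e1 + b *: e2 + c *: e3) e2 e3.
Proof.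
have E x y z : x *: (e1 + b *: e2 + c *: e3) + y *: e2 + z *: e3 =
    x *: e1 + (y + x * b) *: e2 + (z + x * c) *: e3.
  by rewrite !scalerDr !scalerDl !scalerA [LHS](ACl (1*(4*2)*(5*3)))%AC.
split.
- move=> v; have [x [y [z ->]]] := frame_span fr v.
  exists x, (y - x * b), (z - x * c).
  by rewrite E !subrK.
- move=> x y z; rewrite E => /(frame_free fr)[-> + +].
  by rewrite !mul0r !addr0 => -> ->.
- move=> x y z x' y' z'; rewrite !E (frame_br fr); congr (_ *: _).
  by ring.
Qed.

Lemma frame_e1_neq0 : e1 != 0.
Proof.
apply/eqP => e0; have [/eqP] : [/\ 1 = 0 :> R, 0 = 0 :> R & 0 = 0 :> R].
  by apply: (frame_free fr); rewrite e0 !scale0r scaler0 !addr0.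
by rewrite oner_eq0.
Qed.

Lemma frame_e2_neq0 : e2 != 0.
Proof.
apply/eqP => e0; have [_ /eqP] : [/\ 0 = 0 :> R, 1 = 0 :> R & 0 = 0 :> R].
  by apply: (frame_free fr); rewrite e0 !scale0r scaler0 !addr0.
by rewrite oner_eq0.
Qed.

Lemma frame_e3_neq0 : e3 != 0.
Proof.
apply/eqP => e0; have [_ _ /eqP] : [/\ 0 = 0 :> R, 0 = 0 :> R & 1 = 0 :> R].
  by apply: (frame_free fr); rewrite e0 !scale0r scaler0 !addr0.
by rewrite oner_eq0.
Qed.

Lemma frame_br_e1 a b c : br (a *: e1 + b *: e2 + c *: e3) e1 = (- b) *: e2.
Proof.
have := frame_br fr a b c 1 0 0.
by rewrite scale1r !scale0r !addr0 => ->; congr (_ *: _); ring.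
Qed.

Lemma frame_br_e2 a b c : br (a *: e1 + b *: e2 + c *: e3) e2 = a *: e2.
Proof.
have := frame_br fr a b c 0 1 0.
by rewrite scale1r !scale0r addr0 add0r => ->; congr (_ *: _); ring.
Qed.

Lemma frame_br_e3 a b c : br (a *: e1 + b *: e2 + c *: e3) e3 = 0.
Proof.
have := frame_br fr a b c 0 0 1.
by rewrite scale1r !scale0r !add0r => ->; rewrite !mulr0 subrr scale0r.
Qed.

Lemma frame_center : lie_center br = line e3.
Proof.
apply/seteqP; split=> [v vc|v /vlineP[k ->] w].
- have [a [b [c Ev]]] := frame_span fr v.
  have := vc e1; have := vc e2; rewrite Ev frame_br_e1 frame_br_e2.
  move=> /eqP + /eqP; rewrite !scaler_eq0 (negPf frame_e2_neq0) !orbF oppr_eq0.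
  move=> /eqP-> /eqP->; rewrite !scale0r !add0r.
  by apply/vlineP; exists c.
- have [a [b [c ->]]] := frame_span fr w.
  have := frame_br fr 0 0 k a b c; rewrite !scale0r !add0r => ->.
  by rewrite !mul0r subrr scale0r.
Qed.

Lemma frame_derived : derived_subalgebra br = line e2.
Proof.
apply/seteqP; split=> [v vd|v /vlineP[k ->] U Ubr].
- apply: vd => x y; have [a [b [c ->]]] := frame_span fr x.
  have [a' [b' [c' ->]]] := frame_span fr y.
  by rewrite (frame_br fr); apply/vlineP; eexists.
- apply: memvZ; have := Ubr e1 e2; have := frame_br_e2 1 0 0.
  by rewrite !scale1r !scale0r !addr0 => ->.
Qed.

End Frame.

Lemma line_eq u v : u != 0 -> v != 0 -> line u = line v ->
  exists2 k, k != 0 & u = k *: v.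
Proof.
move=> u0 v0 uv; have : line u u by exact: memv_line.
rewrite uv => /vlineP[k Eu]; exists k => //.
by apply: contraNneq u0 => k0; rewrite Eu k0 scale0r.
Qed.

End Frames.

(** * The metric in a frame, spacelike center *)

Section Metric.
Variables (R : realType) (q : {symmetric 'rV[R]_3}).
Implicit Types u v w : 'rV[R]_3.

Lemma sformDl u v w : q (u + v) w = q u w + q v w.
Proof. exact: linearDl. Qed.

Lemma sformDr u v w : q w (u + v) = q w u + q w v.
Proof. by rewrite linearDr. Qed.

Lemma sformZl a u w : q (a *: u) w = a * q u w.
Proof. by rewrite linearZl_LR. Qed.

Lemma sformZr a u w : q w (a *: u) = a * q w u.
Proof. by rewrite linearZr_LR. Qed.

Lemma sform0l w : q 0 w = 0.
Proof. exact: linear0l. Qed.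

Lemma sform0r w : q w 0 = 0.
Proof. exact: linear0r. Qed.

Definition sformE := (sformDl, sformDr, sformZl, sformZr).

Lemma nondegenerate_eq0 u : nondegenerate q -> (forall w, q u w = 0) -> u = 0.
Proof.
move=> q_nd qu0; apply/eqP; rewrite -memv0 -(eqP q_nd).
by apply/mem_orthovP => w _.
Qed.

(** If [q u u <= 0], the positive parts [X] and [Y] of [e] and [u] are bounded by their negative
    parts, strictly for [e]. By orthogonality, Cauchy-Schwarz gives [(C * x3 * y3) ^+ 2 <= X * Y],
    which forces [y3 = 0] and then [u = 0]. *)
Lemma lorentz_timelike_complement e u : lorentzian q ->
  q e e < 0 -> q e u = 0 -> u != 0 -> 0 < q u u.
Proof.
move=> [_ [b1 [b2 [b3 [/basis3P[sp _] [q12 q13 q23] [q1 q2 q3]]]]]].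
have [x1 [x2 [x3 ->]]] := sp e; have [y1 [y2 [y3 ->]]] := sp u.
have [q21 q31 q32] : [/\ q b2 b1 = 0, q b3 b1 = 0 & q b3 b2 = 0].
  by rewrite (sformC q b2 b1) !(sformC q b3).
rewrite !sformE q12 q13 q23 q21 q31 q32.
move: q1 q2 q3; set A := q b1 b1; set B := q b2 b2; set C := q b3 b3.
move=> A0 B0 C0 ee eu u0; rewrite ltNge; apply/negP => uu.
suff [y10 y20 y30] : [/\ y1 = 0, y2 = 0 & y3 = 0].
  by move: u0; rewrite y10 y20 y30 !scale0r !addr0 eqxx.
pose X := A * x1 ^+ 2 + B * x2 ^+ 2; pose Y := A * y1 ^+ 2 + B * y2 ^+ 2.
have X_lt : X < - C * x3 ^+ 2 by rewrite /X; lra.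
have Y_le : Y <= - C * y3 ^+ 2 by rewrite /Y; lra.
have X0 : 0 <= X by rewrite addr_ge0 // mulr_ge0 ?sqr_ge0 ?ltW.
have Y0 : 0 <= Y by rewrite addr_ge0 // mulr_ge0 ?sqr_ge0 ?ltW.
have cs : (C * x3 * y3) ^+ 2 <= X * Y.
  have -> : C * x3 * y3 = - (A * x1 * y1 + B * x2 * y2) by lra.
  rewrite -subr_ge0.
  (* Lagrange's identity for the positive definite part. *)
  have -> : X * Y - (- (A * x1 * y1 + B * x2 * y2)) ^+ 2 =
    A * B * (x1 * y2 - x2 * y1) ^+ 2 by rewrite /X /Y; ring.
  by rewrite mulr_ge0 ?sqr_ge0 // mulr_ge0 ?ltW.
have y30 : y3 = 0.
  apply/eqP/negPn/negP => y3N0.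
  have y32 : 0 < - C * y3 ^+ 2.
    by rewrite mulr_gt0 ?oppr_gt0 // lt_def sqrf_eq0 y3N0 sqr_ge0.
  have : X * Y <= X * (- C * y3 ^+ 2) by rewrite ler_wpM2l.
  have : X * (- C * y3 ^+ 2) < (- C * x3 ^+ 2) * (- C * y3 ^+ 2).
    by rewrite ltr_pM2r.
  have -> : (- C * x3 ^+ 2) * (- C * y3 ^+ 2) = (C * x3 * y3) ^+ 2 by ring.
  by lra.
have /eqP : Y = 0.
  by apply/eqP; rewrite eq_le Y0 andbT; move: Y_le; rewrite y30; lra.
have Ay : 0 <= A * y1 ^+ 2 by rewrite mulr_ge0 ?sqr_ge0 ?ltW.
have By : 0 <= B * y2 ^+ 2 by rewrite mulr_ge0 ?sqr_ge0 ?ltW.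
rewrite /Y paddr_eq0 // !mulf_eq0 !orbb (gt_eqF A0) (gt_eqF B0) !orFb.
by move=> /andP[/eqP-> /eqP->].
Qed.

(** Projecting [b3] off the spacelike [e] only lowers its negative square, and the positive definite
    plane of [b1] and [b2] contains a nonzero vector orthogonal to [e]. So the complement of [e] is
    indefinite. *)
Lemma lorentz_spacelike_complement e : lorentzian q -> 0 < q e e ->
  exists n p, [/\ q e n = 0, q e p = 0, q n n < 0 & 0 < q p p].
Proof.
move=> [_ [b1 [b2 [b3 [_ [q12 q13 q23] [q1 q2 q3]]]]]] ee.
exists (b3 - (q e b3 / q e e) *: e).
have n_orth : q e (b3 - (q e b3 / q e e) *: e) = 0.
  by rewrite -scaleNr !sformE; field; rewrite gt_eqF.
have n_neg : q (b3 - (q e b3 / q e e) *: e) (b3 - (q e b3 / q e e) *: e) < 0.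
  have -> : q (b3 - (q e b3 / q e e) *: e) (b3 - (q e b3 / q e e) *: e) =
      q b3 b3 - q e b3 ^+ 2 / q e e.
    by rewrite -scaleNr !sformE (sformC q b3 e); field; rewrite gt_eqF.
  have : 0 <= q e b3 ^+ 2 / q e e by rewrite divr_ge0 ?sqr_ge0 ?ltW.
  by lra.
have [e20|e2N0] := eqVneq (q e b2) 0; first by exists b2.
exists (q e b2 *: b1 - q e b1 *: b2); split=> //.
  by rewrite -scaleNr !sformE; ring.
have -> : q (q e b2 *: b1 - q e b1 *: b2) (q e b2 *: b1 - q e b1 *: b2) =
    q e b2 ^+ 2 * q b1 b1 + q e b1 ^+ 2 * q b2 b2.
  by rewrite -scaleNr !sformE (sformC q b2 b1) q12; ring.
have H1 : 0 < q e b2 ^+ 2 * q b1 b1.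
  by rewrite mulr_gt0 // lt_def sqrf_eq0 e2N0 sqr_ge0.
have H2 : 0 <= q e b1 ^+ 2 * q b2 b2 by rewrite mulr_ge0 ?sqr_ge0 ?ltW.
by lra.
Qed.

(** * The geodesic field in a frame, idempotents *)

Section Frame.
Variables (br : {bilinear 'rV[R]_3 -> 'rV[R]_3 -> 'rV[R]_3}).
Variables (e1 e2 e3 : 'rV[R]_3).
Hypotheses (q_nd : nondegenerate q) (fr : aff_frame br e1 e2 e3).

Let F := geodesic_field q br.

Lemma form_frame_eq u v : q u e1 = q v e1 -> q u e2 = q v e2 ->
  q u e3 = q v e3 -> u = v.
Proof.
move=> E1 E2 E3; apply/eqP; rewrite -subr_eq0; apply/eqP.
apply: (nondegenerate_eq0 q_nd) => w; have [a [b [c ->]]] := frame_span fr w.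
by rewrite -scaleN1r !sformE E1 E2 E3; ring.
Qed.

Lemma frame_form_neq0 v : v != 0 -> q v e1 = 0 -> q v e2 = 0 -> q v e3 <> 0.
Proof.
move=> /eqP v0 E1 E2 E3; apply: v0.
by apply: form_frame_eq; rewrite sform0l.
Qed.

Lemma geodesic_momenta a b c (v := a *: e1 + b *: e2 + c *: e3) :
  [/\ q (F v) e1 = - b * q v e2, q (F v) e2 = a * q v e2 & q (F v) e3 = 0].
Proof.
rewrite /F /v !(geodesic_fieldP _ q_nd) (frame_br_e1 fr) (frame_br_e2 fr).
by rewrite (frame_br_e3 fr) !sformZr sform0r.
Qed.

(** By nondegeneracy, three products with the frame identify [F v]; explicit values of the field are
    verified through this criterion. *)
Lemma geodesic_eq a b c u (v := a *: e1 + b *: e2 + c *: e3) :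
  q u e1 = - b * q v e2 -> q u e2 = a * q v e2 -> q u e3 = 0 -> u = F v.
Proof.
have [E1 E2 E3] := geodesic_momenta a b c.
by move=> u1 u2 u3; apply: form_frame_eq; rewrite ?E1 ?E2 ?E3.
Qed.

(** As [q v e3 = 0], nullity of [v] reads [q v e1 = - b * q v e2], which is the condition on the
    product with [e1]. The other two are immediate for a = 1. *)
Lemma frame_idempotent b c (v := e1 + b *: e2 + c *: e3) :
  q v e3 = 0 -> q v v = 0 -> F v = v.
Proof.
move=> v3 vv; have Ev : v = 1 *: e1 + b *: e2 + c *: e3 by rewrite scale1r.
rewrite {1}Ev; apply/esym; apply: geodesic_eq => //; rewrite -Ev.
- by move: vv; rewrite /v !sformDr !sformZr -/v v3; lra.
- by rewrite mul1r.
Qed.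

Lemma idempotent_orthogonal v : F v = v -> q v e3 = 0.
Proof.
have [a [b [c ->]]] := frame_span fr v; move=> <-.
by have [_ _ ->] := geodesic_momenta a b c.
Qed.

Lemma geodesicZ k v : F (k *: v) = k ^+ 2 *: F v.
Proof.
have [a [b [c ->]]] := frame_span fr v.
rewrite !scalerDr !scalerA; apply/esym.
have [E1 E2 E3] := geodesic_momenta a b c.
by apply: geodesic_eq; rewrite !sformZl ?E1 ?E2 ?E3 ?sformE; ring.
Qed.

Lemma idempotent_incomplete v : is_idempotent F v -> ~ complete_field F.
Proof.
move=> [v0 Fv]; pose c (t : R) := - t^-1 *: v.
(* A linear functional that detects the blow-up of [c] at 0. *)
have [w qvw] : exists w, q v w != 0.
  apply: contrapT => qv; case/eqP: v0; apply: (nondegenerate_eq0 q_nd) => w.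
  by apply: contrapT => /eqP qvw; apply: qv; exists w.
apply: (incomplete_blowup (c := c) (phi := fun u => q u w : R) (k := - q v w)).
- exact: form_continuous.
- by rewrite oppr_eq0.
- move=> t t0; rewrite /c geodesicZ Fv; apply: is_derive_scalel.
  have tN0 : t != 0 by rewrite gt_eqF.
  have D := is_derive_opp (is_derive_inv tN0 (is_derive_var t)).
  by apply: is_derive_eq D _; field.
- by move=> t t0; rewrite /c sformZl; ring.
Qed.

Lemma spacelike_center_idempotent : lorentzian q -> 0 < q e3 e3 ->
  exists v, is_idempotent F v.
Proof.
move=> q_lor e33; have e33N0 : q e3 e3 != 0 by rewrite gt_eqF.
(* [f1] and [f2] span the complement of [e3]; [A], [B], [C] are the Gram entries of [q] on it. *)
pose f1 := e1 + (- q e1 e3 / q e3 e3) *: e3.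
pose f2 := e2 + (- q e2 e3 / q e3 e3) *: e3.
have f13 : q f1 e3 = 0 by rewrite /f1 !sformE; field.
have f23 : q f2 e3 = 0 by rewrite /f2 !sformE; field.
pose A := q f1 f1; pose B := q f1 f2; pose C := q f2 f2.
have expand u : q e3 u = 0 ->
    exists a b, q u u = A * a ^+ 2 + 2 * B * a * b + C * b ^+ 2.
  move=> u3; have [a [b [c Eu]]] := frame_span fr u.
  exists a, b.
  have Ec : c = - (a * q e1 e3 + b * q e2 e3) / q e3 e3.
    move: u3; rewrite Eu !sformE (sformC q e3 e1) (sformC q e3 e2) => u3.
    apply: (mulIf e33N0); rewrite divfK //; lra.
  rewrite Eu Ec /A /B /C /f1 /f2 !sformE.
  by rewrite (sformC q e3 e1) (sformC q e3 e2) (sformC q e2 e1); field.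
have [n [p [e3n e3p nn pp]]] := lorentz_spacelike_complement q_lor e33.
(* Otherwise [A] times [q] and [C] times [q] are nonnegative on the complement. As [q] takes both
   signs there, [A = 0] and [C = 0], hence [B = 0], contradicting [q n n < 0]. *)
have disc : 0 < B ^+ 2 - A * C.
  rewrite ltNge; apply/negP => disc.
  have [a [b En]] := expand n e3n; have [a' [b' Ep]] := expand p e3p.
  have A_sign x y : 0 <= A * (A * x ^+ 2 + 2 * B * x * y + C * y ^+ 2).
    have -> : A * (A * x ^+ 2 + 2 * B * x * y + C * y ^+ 2) =
      (A * x + B * y) ^+ 2 - (B ^+ 2 - A * C) * y ^+ 2 by ring.
    by rewrite subr_ge0 (le_trans _ (sqr_ge0 _)) // mulr_le0_ge0 ?sqr_ge0.
  have C_sign x y : 0 <= C * (A * x ^+ 2 + 2 * B * x * y + C * y ^+ 2).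
    have -> : C * (A * x ^+ 2 + 2 * B * x * y + C * y ^+ 2) =
      (C * y + B * x) ^+ 2 - (B ^+ 2 - A * C) * x ^+ 2 by ring.
    by rewrite subr_ge0 (le_trans _ (sqr_ge0 _)) // mulr_le0_ge0 ?sqr_ge0.
  have A0 : A = 0.
    have := A_sign a b; have := A_sign a' b'; rewrite -En -Ep.
    rewrite pmulr_lge0 // nmulr_lge0 // => ? ?; lra.
  have C0 : C = 0.
    have := C_sign a b; have := C_sign a' b'; rewrite -En -Ep.
    rewrite pmulr_lge0 // nmulr_lge0 // => ? ?; lra.
  have /eqP : B ^+ 2 = 0.
    by apply/eqP; rewrite eq_le sqr_ge0 andbT; move: disc; rewrite A0; lra.
  by rewrite sqrf_eq0 => /eqP B0; move: nn; rewrite En A0 B0 C0; lra.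
(* The vector [f1 + b *: f2] is to be null: a quadratic equation in [b], or for [C = 0] a linear
   one, where [B != 0] by [disc]. *)
have [b null] : exists b, A + 2 * B * b + C * b ^+ 2 = 0.
  have [C0|C0] := eqVneq C 0.
    have B0 : B != 0.
      by apply: contraTneq disc => ->; rewrite C0 mulr0 expr0n subrr ltxx.
    by exists (- A / (2 * B)); rewrite C0; field.
  exists ((Num.sqrt (B ^+ 2 - A * C) - B) / C).
  have := sqr_sqrtr (ltW disc); move: (Num.sqrt _) => s s2.
  have -> : A = (B ^+ 2 - s ^+ 2) / C by rewrite s2; field.
  by field.
(* With this [c], the vector [v] is [f1 + b *: f2]. *)
pose c := - (q e1 e3 + b * q e2 e3) / q e3 e3.
pose v := e1 + b *: e2 + c *: e3.
have v3 : q v e3 = 0 by rewrite /v /c !sformE; field.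
exists v; split; first exact: frame_e1_neq0 (aff_frame_shift fr b c).
apply: frame_idempotent => //.
rewrite -[RHS]null /A /B /C /f1 /f2 /c !sformE.
by rewrite (sformC q e3 e1) (sformC q e3 e2) (sformC q e2 e1); field.
Qed.

End Frame.
End Metric.

(** * Timelike and lightlike center *)

Section Orthogonal.
Variables (R : realType) (q : {symmetric 'rV[R]_3}).
Variables (br : {bilinear 'rV[R]_3 -> 'rV[R]_3 -> 'rV[R]_3}).
Hypothesis q_nd : nondegenerate q.

(** [D] is the Gram determinant of [e2] and [e3], and Cramer's rule gives the shift of [e1]
    orthogonal to both. The new vector is not null, since otherwise it would be orthogonal to the
    whole frame. *)
Lemma orthogonal_frame e1 e2 e3 : aff_frame br e1 e2 e3 ->
  q e2 e2 * q e3 e3 - q e2 e3 ^+ 2 != 0 ->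
  exists f1, [/\ aff_frame br f1 e2 e3, q f1 e2 = 0, q f1 e3 = 0 &
    q f1 f1 != 0].
Proof.
move=> fr; set D := q e2 e2 * q e3 e3 - q e2 e3 ^+ 2 => D0.
pose b := - (q e1 e2 * q e3 e3 - q e1 e3 * q e2 e3) / D.
pose c := - (q e2 e2 * q e1 e3 - q e2 e3 * q e1 e2) / D.
have fr1 := aff_frame_shift fr b c.
have f12 : q (e1 + b *: e2 + c *: e3) e2 = 0.
  by rewrite !sformE (sformC q e3 e2) /b /c /D; field.
have f13 : q (e1 + b *: e2 + c *: e3) e3 = 0.
  by rewrite !sformE /b /c /D; field.
exists (e1 + b *: e2 + c *: e3); split=> //.
apply/eqP => f11.
exact: (frame_form_neq0 q_nd fr1 (frame_e1_neq0 fr1)).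
Qed.

Variables (e1 e2 e3 : 'rV[R]_3).
Hypothesis fr : aff_frame br e1 e2 e3.
Hypotheses (q12 : q e1 e2 = 0) (q13 : q e1 e3 = 0) (q11 : q e1 e1 != 0).
Let D := q e2 e2 * q e3 e3 - q e2 e3 ^+ 2.
Hypothesis D0 : D != 0.

Let F := geodesic_field q br.

(** [x] is the coordinate along [e1], while [y] and [p] are the products with [e2] and [e3]; the
    other two coefficients invert the Gram matrix of [e2] and [e3]. *)
Definition of_momenta (x y p : R) : 'rV[R]_3 :=
  x *: e1 + ((q e3 e3 * y - q e2 e3 * p) / D) *: e2 +
  ((q e2 e2 * p - q e2 e3 * y) / D) *: e3.

Lemma of_momenta_form x y p :
  [/\ q (of_momenta x y p) e1 = q e1 e1 * x, q (of_momenta x y p) e2 = y &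
      q (of_momenta x y p) e3 = p].
Proof.
rewrite /of_momenta !sformE (sformC q e2 e1) (sformC q e3 e1) (sformC q e3 e2).
by rewrite q12 q13 /D; split; [ring | field | field].
Qed.

Lemma of_momentaE v : v = of_momenta (q v e1 / q e1 e1) (q v e2) (q v e3).
Proof.
have [E1 E2 E3] := of_momenta_form (q v e1 / q e1 e1) (q v e2) (q v e3).
by apply: (form_frame_eq q_nd fr); rewrite ?E1 ?E2 ?E3 //; field.
Qed.

(** Coefficients of the planar system, read off from x' = - b y / [q e1 e1], where b is the
    coefficient of [e2] in [of_momenta]. *)
Let h := q e3 e3 / D / q e1 e1.
Let m p := - q e2 e3 * p / D / q e1 e1.

Lemma geodesic_of_momenta x y p :
  F (of_momenta x y p) = of_momenta (- (h * y ^+ 2 + m p * y)) (x * y) 0.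
Proof.
apply/esym; rewrite {2}/of_momenta; apply: (geodesic_eq q_nd fr);
  rewrite -/(of_momenta x y p);
  have [E1 E2 E3] := of_momenta_form x y p;
  have [G1 G2 G3] := of_momenta_form (- (h * y ^+ 2 + m p * y)) (x * y) 0.
- by rewrite G1 E2 /h /m; field; rewrite D0 q11.
- by rewrite G2 E2.
- by [].
Qed.

Lemma is_derive_of_momenta (x y : R -> R) p (t dx dy : R) :
  is_derive t 1 x dx -> is_derive t 1 y dy ->
  is_derive t 1 (fun s => of_momenta (x s) (y s) p) (of_momenta dx dy 0).
Proof.
move=> xD yD; rewrite /of_momenta; apply: is_derive_comb3 => //.
- by derive; field.
- by derive; field.
Qed.

Lemma planar_geodesic (x y : R -> R) p (t : R) :
  is_derive t 1 x (- (h * y t ^+ 2 + m p * y t)) ->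
  is_derive t 1 y (x t * y t) ->
  is_derive t 1 (fun s => of_momenta (x s) (y s) p)
    (F (of_momenta (x t) (y t) p)).
Proof.
by move=> xD yD; rewrite geodesic_of_momenta; exact: is_derive_of_momenta.
Qed.

(** The field is orthogonal to [e3], so the product with [e3] is conserved and becomes the parameter
    [p]. What remains is the planar system. *)
Lemma geodesic_planar (I : set R) (c : R -> 'rV[R]_3) t0 :
  solution F I c -> I t0 ->
  exists p, [/\ forall t : R, I t ->
      c t = of_momenta (q (c t) e1 / q e1 e1) (q (c t) e2) p,
    forall t, I t -> is_derive t 1 (fun s => q (c s) e1 / q e1 e1)
       (- (h * q (c t) e2 ^+ 2 + m p * q (c t) e2)) &
    forall t, I t -> is_derive t 1 (fun s => q (c s) e2 : R)
       (q (c t) e1 / q e1 e1 * q (c t) e2)].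
Proof.
move=> [_ _ Iitv cD] It0; exists (q (c t0) e3).
have p_cst t : I t -> q (c t) e3 = q (c t0) e3.
  move=> It; apply: (constant_on (f := fun t => q (c t) e3 : R) Iitv) => //.
  move=> s Is.
  apply: is_derive_eq (is_derive_form q e3 (cD s Is)) _.
  rewrite -/F {1}(of_momentaE (c s)) geodesic_of_momenta.
  by have [_ _ ->] := of_momenta_form (- (h * q (c s) e2 ^+ 2 +
    m (q (c s) e3) * q (c s) e2)) (q (c s) e1 / q e1 e1 * q (c s) e2) 0.
have cE t : I t ->
    c t = of_momenta (q (c t) e1 / q e1 e1) (q (c t) e2) (q (c t0) e3).
  by move=> It; rewrite -(p_cst t It); exact: of_momentaE.
have FE s : I s -> F (c s) = of_momenta
    (- (h * q (c s) e2 ^+ 2 + m (q (c t0) e3) * q (c s) e2))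
    (q (c s) e1 / q e1 e1 * q (c s) e2) 0.
  by move=> Is; rewrite {1}(cE s Is) geodesic_of_momenta.
split=> // t It; have [G1 G2 _] := of_momenta_form
    (- (h * q (c t) e2 ^+ 2 + m (q (c t0) e3) * q (c t) e2))
    (q (c t) e1 / q e1 e1 * q (c t) e2) 0.
- have Dt := is_derive_form q e1 (cD t It); derive.
  by rewrite -/F FE // G1; field.
- apply: is_derive_eq (is_derive_form q e2 (cD t It)) _.
  by rewrite -/F FE.
Qed.

Lemma norm_of_momenta_bounded (M p : R) : exists K : R, forall x y,
  `|x| <= M -> `|y| <= M -> `|of_momenta x y p| <= K.
Proof.
pose f (k l : R) := (`|k| * M + `|l * p|) / `|D|.
exists (M * `|e1| + f (q e3 e3) (q e2 e3) * `|e2|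
  + (`|q e2 e2 * p| + `|q e2 e3| * M) / `|D| * `|e3|) => x y xM yM.
rewrite /of_momenta.
rewrite (le_trans (ler_normD _ _)) // lerD //.
  rewrite (le_trans (ler_normD _ _)) // lerD //.
    by rewrite normrZ ler_wpM2r.
  rewrite normrZ ler_wpM2r // /f normrM normfV ler_wpM2r ?invr_ge0 //.
  by rewrite (le_trans (ler_normB _ _)) // lerD // normrM ler_wpM2l.
rewrite normrZ ler_wpM2r // normrM normfV ler_wpM2r ?invr_ge0 //.
by rewrite (le_trans (ler_normB _ _)) // lerD // normrM ler_wpM2l.
Qed.

(** The planar system is solved globally with the data of [c] at [t0]; uniqueness identifies the
    result with [c] on [I]. *)
Lemma orthogonal_frame_complete : 0 < h -> complete_field F.
Proof.
move=> h0; apply: complete_of_global => I c t0 csol It0.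
have [p [cE xD yD]] := geodesic_planar csol It0; have [_ _ Iitv _] := csol.
have [x [y [xt0 yt0 xD' yD']]] :=
  planar_solution (m p) (q (c t0) e1 / q e1 e1) (q (c t0) e2) t0 h0.
exists (fun t => of_momenta (x t) (y t) p) => [t|t It].
  exact: planar_geodesic.
rewrite (cE t It).
by have [-> ->] := planar_unique h0 Iitv It0 (fun s _ => xD' s)
  (fun s _ => yD' s) xD yD xt0 yt0 It.
Qed.

Lemma orthogonal_frame_bounded I c : 0 < h -> integral_curve F I c ->
  bounded_curve I c.
Proof.
move=> h0 [csol _]; have [[t0 It0] _ Iitv _] := csol.
have [p [cE xD yD]] := geodesic_planar csol It0.
have [M _ ME] := planar_bounded (m p) ((q (c t0) e1 / q e1 e1) ^+ 2 +
  h * q (c t0) e2 ^+ 2 + 2 * m p * q (c t0) e2) h0.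
have [K KE] := norm_of_momenta_bounded M p.
apply: (bounded_curve_of (K := K)) => t It; rewrite (cE t It).
have [xM yM] := ME _ _ (planar_energy Iitv It0 xD yD It).
exact: KE.
Qed.

(* If e3 is null then h = 0, and x = -2/t, y = -2/t^2 solve x' = - y,
   y' = x y. *)
Lemma null_center_incomplete : q e3 e3 = 0 -> ~ complete_field F.
Proof.
move=> q33; have q23 : q e2 e3 != 0.
  by apply: contraNneq D0 => q23; rewrite /D q33 q23; apply/eqP; ring.
(* Chosen so that the linear coefficient [m p] is 1. *)
pose p := - (D * q e1 e1) / q e2 e3.
have h0 : h = 0 by rewrite /h q33 !mul0r.
have mp : m p = 1 by rewrite /m /p; field; rewrite q23 D0 q11.
pose x (t : R) := - 2 * t^-1; pose y (t : R) := - 2 * t^-1 ^+ 2.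
apply: (incomplete_blowup (c := fun t => of_momenta (x t) (y t) p)
  (phi := fun u => q u e1 : R) (k := - 2 * q e1 e1)).
- exact: form_continuous.
- by rewrite mulf_neq0 // oppr_eq0 pnatr_eq0.
- move=> t t0; have tN0 : t != 0 by rewrite gt_eqF.
  apply: planar_geodesic; rewrite ?h0 ?mp /x /y.
  + by derive; field.
  + by derive; field.
- move=> t t0; have [-> _ _] := of_momenta_form (x t) (y t) p.
  by rewrite /x; ring.
Qed.

(** An idempotent is orthogonal to [e3], so p = 0 and the linear coefficient vanishes along with
    [h]. Then [F v = v] reads x = 0 and y = x y, forcing [v = 0]. *)
Lemma null_center_no_idempotent : q e3 e3 = 0 -> ~ exists v, is_idempotent F v.
Proof.
move=> q33 [v [/eqP v0 Fv]]; apply: v0.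
have v3 := idempotent_orthogonal q_nd fr Fv.
have h0 : h = 0 by rewrite /h q33 !mul0r.
move: Fv; rewrite (of_momentaE v) v3 geodesic_of_momenta h0.
set x := q v e1 / _; set y := q v e2 => E.
have [Fx Fy _] := of_momenta_form (- (0 * y ^+ 2 + m 0 * y)) (x * y) 0.
have [vx vy _] := of_momenta_form x y 0.
have x0 : x = 0.
  apply: (mulfI q11); rewrite -vx -E Fx /m; ring.
have y0 : y = 0 by rewrite -vy -E Fy x0 mul0r.
by rewrite x0 y0 /of_momenta !mulr0 subrr mul0r !scale0r !addr0.
Qed.

End Orthogonal.

(** * Lightlike center orthogonal to the derived subalgebra *)

Section Degenerate.
Variables (R : realType) (q : {symmetric 'rV[R]_3}).
Variables (br : {bilinear 'rV[R]_3 -> 'rV[R]_3 -> 'rV[R]_3}).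
Hypothesis q_nd : nondegenerate q.

(** If [q e1 e3] or [q e2 e2] vanished, then [e3] or a combination of [e2] and [e3] would be
    orthogonal to the frame. A shift along [e2] makes [e1] orthogonal to [e2]; a further shift along
    [e3] makes it null. *)
Lemma null_frame e1 e2 e3 : aff_frame br e1 e2 e3 ->
  q e3 e3 = 0 -> q e2 e3 = 0 ->
  exists f1, [/\ aff_frame br f1 e2 e3, q f1 f1 = 0, q f1 e2 = 0,
    q f1 e3 != 0 & q e2 e2 != 0].
Proof.
move=> fr q33 q23; have q32 : q e3 e2 = 0 by rewrite sformC.
have q13 : q e1 e3 != 0.
  apply/eqP; rewrite sformC => q31.
  exact: (frame_form_neq0 q_nd fr (frame_e3_neq0 fr)).
have q22 : q e2 e2 != 0.
  apply/eqP => q22; pose u := q e1 e3 *: e2 - q e1 e2 *: e3.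
  have u0 : u = 0.
    apply: (form_frame_eq q_nd fr); rewrite sform0l /u -scaleNr !sformE
      ?(sformC q e2 e1) ?(sformC q e3 e1) ?q22 ?q32 ?q23 ?q33; ring.
  have [|_ /eqP] := frame_free fr (a := 0) (b := q e1 e3) (c := - q e1 e2).
    by rewrite scale0r add0r scaleNr.
  by rewrite (negPf q13).
pose b := - q e1 e2 / q e2 e2.
pose c := - (q e1 e1 + 2 * b * q e1 e2 + b ^+ 2 * q e2 e2) / (2 * q e1 e3).
exists (e1 + b *: e2 + c *: e3); split=> //.
- exact: aff_frame_shift.
- rewrite !sformE (sformC q e2 e1) (sformC q e3 e1) q32 q23 q33 /c /b.
  by field; rewrite q13 q22.
- by rewrite !sformE q32 /b; field.
- by rewrite !sformE q23 q33 !mulr0 !addr0.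
Qed.

Variables (e1 e2 e3 : 'rV[R]_3).
Hypothesis fr : aff_frame br e1 e2 e3.
Hypotheses (q11 : q e1 e1 = 0) (q12 : q e1 e2 = 0) (q23 : q e2 e3 = 0).
Hypotheses (q33 : q e3 e3 = 0) (q13 : q e1 e3 != 0) (q22 : q e2 e2 != 0).

Let F := geodesic_field q br.

(** [a] is the coordinate along [e1], which is the product with [e3] up to the factor [q e1 e3]; [y]
    and [z] are the products with [e2] and [e1]. *)
Definition of_null_momenta (a y z : R) : 'rV[R]_3 :=
  a *: e1 + (y / q e2 e2) *: e2 + (z / q e1 e3) *: e3.

Lemma of_null_momenta_form a y z :
  [/\ q (of_null_momenta a y z) e1 = z, q (of_null_momenta a y z) e2 = y &
      q (of_null_momenta a y z) e3 = a * q e1 e3].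
Proof.
rewrite /of_null_momenta !sformE (sformC q e2 e1) (sformC q e3 e1)
  (sformC q e3 e2) q11 q12 q23 q33.
by rewrite !mulr0 !addr0 !add0r !divfK.
Qed.

Lemma of_null_momentaE v :
  v = of_null_momenta (q v e3 / q e1 e3) (q v e2) (q v e1).
Proof.
have [E1 E2 E3] := of_null_momenta_form (q v e3 / q e1 e3) (q v e2) (q v e1).
by apply: (form_frame_eq q_nd fr); rewrite ?E1 ?E2 ?E3 //; field.
Qed.

Lemma geodesic_of_null_momenta a y z :
  F (of_null_momenta a y z) = of_null_momenta 0 (a * y) (- (y ^+ 2 / q e2 e2)).
Proof.
have [E1 E2 E3] := of_null_momenta_form a y z.
have [G1 G2 G3] := of_null_momenta_form 0 (a * y) (- (y ^+ 2 / q e2 e2)).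
apply/esym; rewrite {2}/of_null_momenta.
apply: (geodesic_eq q_nd fr); rewrite -/(of_null_momenta a y z).
- by rewrite G1 E2; field.
- by rewrite G2 E2.
- by rewrite G3 mul0r.
Qed.

Lemma null_geodesic a (y z : R -> R) (t : R) :
  is_derive t 1 y (a * y t) -> is_derive t 1 z (- (y t ^+ 2 / q e2 e2)) ->
  is_derive t 1 (fun s => of_null_momenta a (y s) (z s))
    (F (of_null_momenta a (y t) (z t))).
Proof.
move=> yD zD; rewrite geodesic_of_null_momenta /of_null_momenta.
apply: is_derive_comb3.
- by derive; ring.
- by derive; ring.
Qed.

Lemma geodesic_null (I : set R) (c : R -> 'rV[R]_3) t0 :
  solution F I c -> I t0 ->
  exists a, [/\ forall t : R, I t ->
      c t = of_null_momenta a (q (c t) e2) (q (c t) e1),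
    forall t, I t -> is_derive t 1 (fun s => q (c s) e2 : R) (a * q (c t) e2) &
    forall t, I t -> is_derive t 1 (fun s => q (c s) e1 : R)
      (- (q (c t) e2 ^+ 2 / q e2 e2))].
Proof.
move=> [_ _ Iitv cD] It0; exists (q (c t0) e3 / q e1 e3).
have FE s := geodesic_of_null_momenta (q (c s) e3 / q e1 e3) (q (c s) e2)
  (q (c s) e1).
have FM s := of_null_momenta_form 0 (q (c s) e3 / q e1 e3 * q (c s) e2)
  (- (q (c s) e2 ^+ 2 / q e2 e2)).
have p_cst t : I t -> q (c t) e3 = q (c t0) e3.
  move=> It; apply: (constant_on (f := fun t => q (c t) e3 : R) Iitv) => //.
  move=> s Is.
  apply: is_derive_eq (is_derive_form q e3 (cD s Is)) _.
  rewrite -/F {1}(of_null_momentaE (c s)) FE.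
  by have [_ _ ->] := FM s; rewrite mul0r.
split=> t It.
- by rewrite -(p_cst t It); exact: of_null_momentaE.
- apply: is_derive_eq (is_derive_form q e2 (cD t It)) _.
  rewrite -/F {1}(of_null_momentaE (c t)) FE -(p_cst t It).
  by have [_ -> _] := FM t.
- apply: is_derive_eq (is_derive_form q e1 (cD t It)) _.
  rewrite -/F {1}(of_null_momentaE (c t)) FE.
  by have [-> _ _] := FM t.
Qed.

Lemma null_frame_complete : complete_field F.
Proof.
apply: complete_of_global => I c t0 csol It0.
have [a [cE yD zD]] := geodesic_null csol It0; have [_ _ Iitv _] := csol.
have [y [z [yt0 zt0 yD' zD' _]]] :=
  triangular_solution a (q (c t0) e2) (q (c t0) e1) t0 q22.
exists (fun t => of_null_momenta a (y t) (z t)) => [t|t It].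
  exact: null_geodesic.
rewrite (cE t It).
by have [-> ->] := triangular_unique Iitv It0 (fun s _ => yD' s)
  (fun s _ => zD' s) yD zD yt0 zt0 It.
Qed.

(** By completeness the curve is an explicit triangular solution on the whole line. It is stationary
    if [q (c 0) e2 = 0]; otherwise a product with [e1] or [e2] exceeds every bound, against
    [form_bound]. *)
Lemma null_frame_unbounded I c : integral_curve F I c -> ~ stationary I c ->
  ~ bounded_curve I c.
Proof.
move=> c_int c_nst /bounded_curveP[K cK].
have IT := null_frame_complete c_int; case: c_int => csol _.
rewrite {}IT in csol cK c_nst *.
have [a [cE yD zD]] := geodesic_null (t0 := 0) csol Logic.I.
have [y [z [y0 z0 yD' zD' [fix0 big]]]] :=
  triangular_solution a (q (c 0) e2) (q (c 0) e1) 0 q22.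
have yz t : y t = q (c t) e2 /\ z t = q (c t) e1.
  by apply: (triangular_unique (u := fun t => q (c t) e2 : R)
    (v := fun t => q (c t) e1 : R) (t0 := 0) (I := setT) (a := a)
    (B := q e2 e2)).
have [y00|y0N0] := eqVneq (q (c 0) e2) 0.
  apply: c_nst; exists (c 0) => t _; rewrite (cE t) // (cE 0) //.
  have [<- <-] := yz t; have [-> ->] := fix0 y00 t.
  by rewrite y00.
have [K1 K10 K1E] := form_bound q e1; have [K2 K20 K2E] := form_bound q e2.
have [t] := big y0N0 (K1 * K + K2 * K).
have [-> ->] := yz t; have cKt := cK t Logic.I.
have H1 : `|q (c t) e1| <= K1 * K.
  by apply: le_trans (K1E _) _; rewrite ler_wpM2l.
have H2 : `|q (c t) e2| <= K2 * K.
  by apply: le_trans (K2E _) _; rewrite ler_wpM2l.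
have K0 : 0 <= K by exact: le_trans cKt.
have P1 : 0 <= K1 * K by exact: mulr_ge0.
have P2 : 0 <= K2 * K by exact: mulr_ge0.
by case; lra.
Qed.

End Degenerate.

(** * Reduction of the four cases to adapted frames *)

(** Generators of a line differ by a nonzero factor, whose square is [r]. So the causal type of the
    center is read off from [e3]. *)
Lemma line_form (R : realType) (q : {symmetric 'rV[R]_3}) e v : e != 0 ->
  v != 0 -> line e = line v -> exists2 r, 0 < r & q e e = r * q v v.
Proof.
move=> e0 v0 /(line_eq e0 v0)[k k0 ->]; exists (k ^+ 2);
  last by rewrite !sformE; ring.
by rewrite lt_def sqrf_eq0 k0 sqr_ge0.
Qed.

Theorem theorem1p1 (R : realType)
    (br : {bilinear 'rV[R]_3 -> 'rV[R]_3 -> 'rV[R]_3})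
    (q : {symmetric 'rV[R]_3}) :
  aff_plus_R br -> lorentzian q ->
  let z := lie_center br in
  let d := derived_subalgebra br in
  let F := geodesic_field q br in
  (one_dimensional z /\ one_dimensional d) /\
  [/\ (spacelike q z ->
        ~ complete_field F /\ exists v, is_idempotent F v),
      (timelike q z ->
        complete_field F /\
        forall I c, integral_curve F I c -> bounded_curve I c),
      (lightlike q z -> ~ orthogonal_sets q z d ->
        ~ complete_field F /\ ~ exists v, is_idempotent F v) &
      (lightlike q z -> orthogonal_sets q z d ->
        complete_field F /\
        forall I c, integral_curve F I c -> ~ stationary I c ->
          ~ bounded_curve I c)].
Proof.
move=> /aff_frame_exists[e1 [e2 [e3 fr]]] q_lor z d F.
have q_nd : nondegenerate q by case: q_lor.
have e20 := frame_e2_neq0 fr; have e30 := frame_e3_neq0 fr.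
rewrite /z /d (frame_center fr) (frame_derived fr).
have orthE : orthogonal_sets q (line e3) (line e2) <-> q e2 e3 = 0.
  split=> [/(_ e3 e2)|q23 _ _ /vlineP[k ->] /vlineP[l ->]].
    by rewrite sformC; apply; exact: memv_line.
  by rewrite !sformE sformC q23; ring.
split; first by split; [exists e3 | exists e2].
split.
- move=> [v [v0 /(line_form q e30 v0)[r r0 q33] vv]].
  have [u u_id] : exists u, is_idempotent F u.
    by apply: (spacelike_center_idempotent q_nd fr q_lor); rewrite q33 mulr_gt0.
  by split; [exact: (idempotent_incomplete q_nd fr u_id) | exists u].
- move=> [v [v0 /(line_form q e30 v0)[r r0 q33] vv]].
  have {}q33 : q e3 e3 < 0 by rewrite q33 pmulr_rlt0.
  have q33N0 : q e3 e3 != 0 by rewrite lt_eqF.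
  (* The part [u] of [e2] orthogonal to [e3] is spacelike, and [q u u] is the Gram determinant
     divided by the negative [q e3 e3]. *)
  have D0 : q e2 e2 * q e3 e3 - q e2 e3 ^+ 2 < 0.
    pose u := e2 + (- q e2 e3 / q e3 e3) *: e3.
    have u0 : u != 0.
      apply/eqP => u0; have := frame_free fr (a := 0) (b := 1)
        (c := - q e2 e3 / q e3 e3); rewrite scale0r add0r scale1r => /(_ u0).
      by case=> _ /eqP; rewrite oner_eq0.
    have := lorentz_timelike_complement q_lor q33 _ u0.
    have -> : q u u = (q e2 e2 * q e3 e3 - q e2 e3 ^+ 2) / q e3 e3.
      by rewrite /u !sformE (sformC q e3 e2); field.
    rewrite nmulr_lgt0 ?invr_lt0 //; apply.
    by rewrite /u !sformE (sformC q e3 e2); field.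
  have [f1 [fr1 q12 q13 q11]] := orthogonal_frame q_nd fr (ltr0_neq0 D0).
  have q11_gt0 : 0 < q f1 f1.
    apply: (lorentz_timelike_complement q_lor q33).
      by rewrite sformC.
    exact: frame_e1_neq0 fr1.
  have h0 : 0 < q e3 e3 / (q e2 e2 * q e3 e3 - q e2 e3 ^+ 2) / q f1 f1.
    by rewrite divr_gt0 // nmulr_rgt0 // invr_lt0.
  split.
    exact: (orthogonal_frame_complete q_nd fr1 q12 q13 q11 (ltr0_neq0 D0) h0).
  move=> I c.
  exact: (orthogonal_frame_bounded q_nd fr1 q12 q13 q11 (ltr0_neq0 D0) h0).
- move=> [v [v0 /(line_form q e30 v0)[r r0 q33] vv]] /orthE/eqP q23.
  have {}q33 : q e3 e3 = 0 by rewrite q33 vv mulr0.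
  (* With [e3] null the Gram determinant is [- q e2 e3 ^+ 2], so it vanishes exactly when center and
     derived subalgebra are orthogonal. *)
  have D0 : q e2 e2 * q e3 e3 - q e2 e3 ^+ 2 != 0.
    by rewrite q33 mulr0 sub0r oppr_eq0 sqrf_eq0.
  have [f1 [fr1 q12 q13 q11]] := orthogonal_frame q_nd fr D0.
  split.
    exact: (null_center_incomplete q_nd fr1 q12 q13 q11 D0 q33).
  exact: (null_center_no_idempotent q_nd fr1 q12 q13 q11 D0 q33).
- move=> [v [v0 /(line_form q e30 v0)[r r0 q33] vv]] /orthE q23.
  have {}q33 : q e3 e3 = 0 by rewrite q33 vv mulr0.
  have [f1 [fr1 q11 q12 q13 q22]] := null_frame q_nd fr q33 q23.
  split; first exact: (null_frame_complete q_nd fr1).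
  move=> I c.
  exact: (null_frame_unbounded q_nd fr1).
Qed.
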